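(* If $q=3^{2\ell+1}$ for a non-negative integer $\ell$, then the intersection density of $\mathrm{PSL}_2(q)$ under its action on the $3$-subsets of $\{1,\dots,q+1\}$ is $\frac{q}{3}$.
   Context: $\mathrm{PSL}_2(q)$ acts naturally on the $q+1$ points of the projective line over $\mathbb{F}_q$ (identified with $\{1,\dots,q+1\}$), and hence on its $3$-subsets; for $q\equiv 3 \pmod 4$ (as is the case here) the action on $3$-subsets is transitive. For a finite group $G$ acting transitively on a finite set $V$, a subset $\mathcal{F}\subseteq G$ is intersecting if for any $g,h\in\mathcal{F}$ there is $v\in V$ with $g(v)=h(v)$. The intersection density of $G$ in this action is $\rho(G)=\max\{ |\mathcal{F}|\,|V|/|G| : \mathcal{F}\subseteq G \text{ intersecting}\}$. Here $V$ is the set of $3$-subsets of $\{1,\dots,q+1\}$. *)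

(* Defs.v *)
From mathcomp Require Import all_boot all_order all_algebra.
From mathcomp Require Import all_fingroup all_solvable all_field all_character.

Set Implicit Arguments.
Unset Strict Implicit.
Unset Printing Implicit Defensive.

Import Order.TTheory GroupScope GRing.Theory Num.Theory.
Local Open Scope ring_scope.

(* Here [to v g] is the image of the point v under the group element g. *)
Definition intersecting (aT : finGroupType) (D : {set aT}) (rT : finType)
    (to : action D rT) (V : {set rT}) (A : {set aT}) : bool :=
  [forall g in A, forall h in A, exists v in V, to v g == to v h].

(* The empty family is intersecting and all the ratios are nonnegative, so the
   default value 0 of the iterated maximum is harmless. *)
Definition intersection_density (aT : finGroupType) (D : {set aT})
    (rT : finType) (to : action D rT) (G : {set aT}) (V : {set rT}) : rat :=
  \big[Num.max/0]_(A : {set aT} | (A \subset G) && intersecting to V A)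
     (#|A|%:R * #|V|%:R / #|G|%:R).

Definition SL2 (F : finFieldType) : {set {'GL_2[F]}} :=
  [set g : {'GL_2[F]} | \det (GLval g) == 1].

Lemma SL2_group_set (F : finFieldType) : group_set (SL2 F).
Proof.
apply/group_setP; split=> [|g h]; first by rewrite inE GL_1E det1.
by rewrite !inE GL_MxE det_mulmx => /eqP -> /eqP ->; rewrite mulr1.
Qed.

Canonical SL2_group (F : finFieldType) := Group (SL2_group_set F).

Definition PSL2 (F : finFieldType) : {set coset_of 'Z(SL2 F)} :=
  (SL2 F / 'Z(SL2 F))%g.

Canonical PSL2_group (F : finFieldType) := [group of PSL2 F].

(* A point of the projective line is a line through 0 in F^2, given as the set
   of its vectors: [rowg v] is the row space of v. *)
Definition proj_line (F : finFieldType) : {set {set 'rV[F]_2}} :=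
  [set rowg v | v : 'rV[F]_2 & v != 0].

Definition three_subsets (T : finType) (X : {set T}) : {set {set T}} :=
  [set S : {set T} | S \subset X & #|S| == 3].

(* The natural action v |-> v *m g on row vectors, extended to sets of vectors
   and to sets of such sets. *)
Definition GL2_act (F : finFieldType) :
    action 'GL_2[F] {set {set 'rV[F]_2}} :=
  (('MR (GLrepr F 1))^*^*)%act.

(* [_ %% _] only descends to the quotient on the points fixed by 'Z(SL2 F), and
   is trivial on the others; see [PSL2_actE] for its value on 3-subsets. *)
Definition PSL2_act (F : finFieldType) :
    action ('GL_2[F] / 'Z(SL2 F))%g {set {set 'rV[F]_2}} :=
  (GL2_act F %% 'Z(SL2 F))%act.

Lemma center_SL2_scalar (F : finFieldType) (z : {'GL_2[F]}) :
  z \in 'Z(SL2 F)%g -> exists a : F, GLval z = a%:M.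
Proof.
case/setIP=> _ /centP cz.
have C (i j k l : 'I_2) : i != j ->
    (GLval z *m delta_mx i j) k l = (delta_mx i j *m GLval z) k l.
  move=> ij; pose u : 'M[F]_2 := 1%:M + delta_mx i j.
  have du : \det u = 1.
    rewrite (expand_det_row _ ord0) !big_ord_recl big_ord0 /cofactor !det_mx11.
    rewrite !mxE; move: ij; case: i j @u => [[|[|//]] ?] [[|[|//]] ?] //= _.
      by rewrite !(mul1r, mulr0, addr0, mulr1, expr0).
    by rewrite !(mul1r, mul0r, mulr0, addr0, mulr1, expr0).
  have Uu : u \in unitmx by rewrite unitmxE du unitr1.
  pose w : {'GL_2[F]} := FinRing.unit 'M[F]_2 Uu.
  have /cz : w \in SL2 F by rewrite inE /= du.
  move/(congr1 GLval); rewrite !GL_MxE /= /u.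
  by rewrite mulmxDl mulmxDr mulmx1 mul1mx => /addrI ->.
exists (GLval z ord0 ord0); apply/matrixP=> i j.
have := C ord0 ord_max ord0 ord_max isT.
have := C ord0 ord_max ord0 ord0 isT.
have := C ord_max ord0 ord_max ord_max isT.
rewrite !mxE !big_ord_recl !big_ord0 !mxE /=.
rewrite !(mulr0, mul0r, mulr1, mul1r, addr0, add0r).
have -> : lift ord0 ord0 = ord_max :> 'I_2 by apply/val_inj.
move=> z01 z10 z11; have ord2 (k : 'I_2) : k = ord0 \/ k = ord_max.
  by case: k => [[|[|//]] ?]; [left | right]; apply/val_inj.
by case: (ord2 i) (ord2 j) => -> [] ->; rewrite -?z01 -?z10 -?z11.
Qed.

Lemma GL2_actE (F : finFieldType) (S : {set {set 'rV[F]_2}}) (g : {'GL_2[F]}) :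
  GL2_act F S g = [set [set v *m GLval g | v in L] | L : {set 'rV[F]_2} in S].
Proof.
apply: eq_imset => L; apply: eq_imset => v.
by rewrite /= mx_repr_actE ?inE.
Qed.

Lemma PSL2_actE (F : finFieldType) (S : {set {set 'rV[F]_2}})
    (g : {'GL_2[F]}) :
  g \in SL2 F -> S \in three_subsets (proj_line F) ->
  PSL2_act F S (coset 'Z(SL2 F) g) =
    [set [set v *m GLval g | v in L] | L : {set 'rV[F]_2} in S].
Proof.
move=> Sg /[!inE] /andP[/subsetP SP _]; rewrite -GL2_actE.
apply: modactE => //.
  exact: (subsetP (normal_norm (center_normal _)) g Sg).
apply/afixP => z /setIP[_ Zz]; rewrite GL2_actE.
have [a za] := center_SL2_scalar Zz.
have a0 : a != 0.
  apply/eqP => a0; have := GL_unitmx z.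
  by rewrite /= za a0 unitmxE det_scalar expr0n unitr0.
rewrite -[RHS]imset_id; apply: eq_in_imset => L /SP /imsetP[u _ ->{L}].
apply/setP => w; apply/imsetP/idP => [[v] | ].
  by rewrite !inE => vu ->; rewrite za mul_mx_scalar scalemx_sub.
rewrite inE => wu; exists (a^-1 *: w); first by rewrite inE scalemx_sub.
by rewrite za mul_mx_scalar scalerA divff // scale1r.
Qed.

(* Main.v *)
Require Import Defs.
From mathcomp Require Import all_boot all_order all_algebra.
From mathcomp Require Import all_fingroup all_solvable all_field all_character.
From mathcomp Require Import ring.

Set Implicit Arguments.
Unset Strict Implicit.
Unset Printing Implicit Defensive.

Import Order.TTheory GroupScope GRing.Theory Num.Theory.
Local Open Scope ring_scope.

(** Write V for the set of 3-subsets of the projective line and area for the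
    determinant form on row vectors.  Two elements x, y of PSL_2(q) agree on
    some 3-subset iff x y^-1 fixes one, and the proof rests on the fact that,
    for q an odd power of 3, this happens exactly when a matrix of x y^-1 has
    trace 2 or -2, i.e. when x y^-1 is the class of a transvection
    T(c, v) : w |-> w + c area(w, v) v.

    - Three points are the lines of three vectors of zero sum, unique up to a
      common factor.  An element of SL_2 that permutes the lines multiplies
      these vectors by one common scalar, whose square is the sign of the
      permutation.  As -1 is not a square, the permutation is even, and the
      trace is 2 or -1 = 2, up to sign ([three_stabilizer_tr]).
    - Conversely T(c, v) permutes the lines of w, w - c v and w + c v
      cyclically if area(v, w) = 1, because 3 = 0
      ([transvection_fixes_three]).

    The transvections along one v form a group of order q, so their ratios are
    transvections again and they are an intersecting family of size q
    ([transvections_intersecting]). For the upper bound, translate an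
    intersecting family so that it contains 1; its elements are now classes of
    transvections. The trace of T(c, v) T(d, w)^-1 is 2 + c d area(v, w)^2, so
    c d area(v, w)^2 is 0 or -1 for any two members ([clique_area]). Either all
    members share one direction v, and there are at most q of them; or two
    members T(c, v) and T(d, w) have different directions. In the second case a
    further member T(e, u), other than 1, cannot have a direction different
    from both, since the product of the three quantities would make -1 a
    square; if u is along v, say, then the condition with T(d, w) forces it to
    equal T(c, v). So the family has at most 3 elements ([card_clique1]).

    Finally |PSL_2(q)| = q (q^2 - 1) / 2 is three times |V| = C(q + 1, 3), so
    that the density is q |V| / |PSL_2(q)| = q / 3. *)

(** * Families of cosets with constrained ratios *)

Section RatioCliques.

Variables (gT : finGroupType) (G Z : {group gT}) (P : gT -> Prop).
Hypothesis nZG : G \subset 'N(Z)%g.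
Implicit Types (g h : gT) (A : {set coset_of Z}).

(** The ratio is formed in [G] and not in [G / Z] because [P] will be a
    condition on matrices, which their class determines only up to sign. *)
Definition ratio_clique A : Prop :=
  forall g h, g \in G -> h \in G -> coset Z g \in A -> coset Z h \in A ->
    P (g * h^-1)%g.

(** Right translation leaves the ratios unchanged, so that a clique can be
    assumed to contain 1. *)
Lemma ratio_cliqueM A x :
  x \in (G / Z)%g -> ratio_clique A -> ratio_clique (A :* x)%g.
Proof.
case/morphimP=> k Nk Gk -> clA g h Gg Gh; rewrite !mem_rcoset.
have [Ng Nh] := (subsetP nZG g Gg, subsetP nZG h Gh).
rewrite -morphV // -!morphM ?groupV // => gA hA.
have <- : ((g * k^-1) * (h * k^-1)^-1 = g * h^-1)%g.
  by rewrite invMg invgK mulgA mulgKV.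
by apply: clA gA hA; rewrite groupM ?groupV.
Qed.

Lemma act_eq_fixP (T : finType) (to : {action gT &-> T}) (v : T) g h :
  to v g = to v h <-> to v (g * h^-1)%g = v.
Proof.
rewrite actM; split=> [-> | ghv]; first by rewrite actK.
by rewrite -[in RHS]ghv actKV.
Qed.

(** The action [toZ] of the quotient agrees with [to] on [V] only, which is why
    it is related to [to] by a hypothesis. *)
Lemma intersecting_ratio_clique (T : finType) (to : {action gT &-> T})
    (D : {set coset_of Z}) (toZ : action D T) (V : {set T}) A :
  (forall g v, g \in G -> v \in V -> toZ v (coset Z g) = to v g) ->
  (forall g v, g \in G -> v \in V -> to v g = v -> P g) ->
  intersecting toZ V A -> ratio_clique A.
Proof.
move=> toZE VP /forall_inP intA g h Gg Gh.
move=> /intA /forall_inP/[apply] /exists_inP[v Vv].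
rewrite !toZE // => /eqP /act_eq_fixP; apply: VP => //.
by rewrite groupM ?groupV.
Qed.

End RatioCliques.

(** * The area form and transvections of the plane *)

Section Plane.

Variable F : fieldType.
Implicit Types (u v w : 'rV[F]_2) (g : 'M[F]_2) (a b c d : F).

Lemma ord2P (P : 'I_2 -> Prop) : P ord0 -> P ord_max -> forall i, P i.
Proof.
move=> P0 P1 [[|[|//]] lti]; [move: P0 | move: P1]; congr P; exact: val_inj.
Qed.

Lemma sum_ord2 (f : 'I_2 -> F) : \sum_i f i = f ord0 + f ord_max.
Proof.
rewrite !big_ord_recl big_ord0 addr0; congr (_ + f _); exact: val_inj.
Qed.

Lemma det_mx22 g :
  \det g = g ord0 ord0 * g ord_max ord_max - g ord0 ord_max * g ord_max ord0.
Proof.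
rewrite (expand_det_row _ ord0) sum_ord2 /cofactor !det_mx11 !mxE /=.
rewrite expr0 expr1 mul1r mulN1r mulrN; congr (_ * g _ _ - _ * g _ _);
exact: val_inj.
Qed.

Definition area u v : F := u 0 ord0 * v 0 ord_max - u 0 ord_max * v 0 ord0.

Lemma areavv v : area v v = 0.
Proof. by rewrite /area; ring. Qed.

Lemma areaC u v : area u v = - area v u.
Proof. by rewrite /area; ring. Qed.

Lemma areaDl u v w : area (u + v) w = area u w + area v w.
Proof. by rewrite /area !mxE; ring. Qed.

Lemma areaDr u v w : area w (u + v) = area w u + area w v.
Proof. by rewrite /area !mxE; ring. Qed.

Lemma areaZl c u v : area (c *: u) v = c * area u v.
Proof. by rewrite /area !mxE; ring. Qed.

Lemma areaZr c u v : area u (c *: v) = c * area u v.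
Proof. by rewrite /area !mxE; ring. Qed.

Lemma areaNl u v : area (- u) v = - area u v.
Proof. by rewrite /area !mxE; ring. Qed.

Lemma areaNr u v : area u (- v) = - area u v.
Proof. by rewrite /area !mxE; ring. Qed.

Lemma area_mulmx g u v : area (u *m g) (v *m g) = \det g * area u v.
Proof. by rewrite /area !mxE !sum_ord2 det_mx22; ring. Qed.

(** The derivative at the identity of [area_mulmx]: it gives the trace of [g]
    from the images of two vectors, in no particular basis. *)
Lemma mxtrace_area g u v :
  \tr g * area u v = area (u *m g) v + area u (v *m g).
Proof. by rewrite /area /mxtrace !mxE !sum_ord2; ring. Qed.

(** Cramer's rule for three vectors of the plane. *)
Lemma area_relation u v w :
  area v w *: u + area w u *: v + area u v *: w = 0.
Proof.
by apply/rowP; apply: ord2P; rewrite /area !mxE; ring.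
Qed.

Lemma rV2_eq0 v : (v == 0) = (v 0 ord0 == 0) && (v 0 ord_max == 0).
Proof.
apply/eqP/andP=> [-> | [/eqP v0 /eqP v1]]; first by rewrite !mxE.
by apply/rowP; apply: ord2P; rewrite !mxE.
Qed.

Lemma area_dual v : v != 0 -> exists w, area v w = 1.
Proof.
rewrite rV2_eq0 negb_and => /orP[v0 | v1].
  exists (\row_j (if j == ord0 then 0 else (v 0 ord0)^-1)).
  by rewrite /area !mxE /=; field.
exists (\row_j (if j == ord0 then - (v 0 ord_max)^-1 else 0)).
by rewrite /area !mxE /=; field.
Qed.

Lemma area0_colinear u v : u != 0 -> area u v = 0 -> exists a, v = a *: u.
Proof.
move=> /area_dual[w uw1] uv0; exists (area v w).
have := area_relation u v w; rewrite uv0 scale0r addr0 (areaC w) uw1 scaleN1r.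
by move/eqP; rewrite subr_eq0 => /eqP.
Qed.

Lemma area_neq0 u v : area u v != 0 -> (u != 0) && (v != 0).
Proof.
by apply: contraNT; rewrite negb_and !negbK => /orP[] /eqP ->;
  rewrite /area !mxE ?(mul0r, mulr0) subrr.
Qed.

Lemma area_delta v :
  (area (delta_mx 0 ord0) v = v 0 ord_max)
  * (area (delta_mx 0 ord_max) v = - v 0 ord0).
Proof. by rewrite /area !mxE /=; split; ring. Qed.

(** Row [i] is the image of the [i]-th basis vector under the map of
    [mul_transvection]. *)
Definition transvection c v : 'M[F]_2 :=
  \matrix_(i, j) ((i == j)%:R + c * area (delta_mx 0 i) v * v 0 j).

Lemma mul_transvection c v w : w *m transvection c v = w + (c * area w v) *: v.
Proof.
apply/rowP; apply: ord2P;
by rewrite !mxE sum_ord2 !mxE !area_delta /area /=; ring.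
Qed.

Lemma det_transvection c v : \det (transvection c v) = 1.
Proof. by rewrite det_mx22 !mxE !area_delta /area /=; ring. Qed.

Lemma transvectionZ c a v :
  transvection c (a *: v) = transvection (c * a ^+ 2) v.
Proof. by apply/matrixP=> i j; rewrite !mxE areaZr; ring. Qed.

Lemma transvection0 v : transvection 0 v = 1%:M.
Proof. by apply/matrixP=> i j; rewrite !mxE !mul0r addr0. Qed.

Lemma transvectionD c d v :
  transvection c v *m transvection d v = transvection (c + d) v.
Proof.
apply/row_matrixP=> i; rewrite !rowE mulmxA !mul_transvection areaDl areaZl.
by rewrite areavv mulr0 addr0 mulrDl scalerDl addrA.
Qed.

(** The sign of [d] makes the left-hand side the trace of a ratio of
    transvections. *)
Lemma tr_transvectionM c d v w :
  \tr (transvection c v *m transvection (- d) w)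
  = 2%:R + c * d * area v w ^+ 2.
Proof.
rewrite /mxtrace sum_ord2 ![(_ *m _) _ _]mxE !sum_ord2.
rewrite ![transvection _ _ _ _]mxE.
by rewrite !area_delta /area /=; ring.
Qed.

(** Since [g - 1] is nilpotent its entries satisfy [(x - 1)^2 + b d = 0], and
    [v] can be taken in its image, which is a line unless [g = 1]. *)
Lemma unipotent_transvection g :
  \det g = 1 -> \tr g = 2%:R -> exists c v, v != 0 /\ g = transvection c v.
Proof.
rewrite det_mx22 /mxtrace sum_ord2 => det1 tr2.
set x := g ord0 ord0 in det1 tr2 *; set y := g ord_max ord_max in det1 tr2 *.
set b := g ord0 ord_max in det1 *; set d := g ord_max ord0 in det1 *.
have yE : y = 2%:R - x by rewrite -tr2; ring.
have nil : (x - 1) ^+ 2 + b * d = 0.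
  have -> : (x - 1) ^+ 2 + b * d = 1 - (x * y - b * d) by rewrite yE; ring.
  by rewrite det1 subrr.
have [b0 | b0] := eqVneq b 0.
  have x1 : x = 1.
    apply/eqP; rewrite -subr_eq0 -sqrf_eq0; move/eqP: nil.
    by rewrite b0 mul0r addr0.
  exists (- d), (\row_j (j == ord0)%:R); split.
    by rewrite rV2_eq0 !mxE /= oner_eq0.
  apply/matrixP; apply: ord2P; apply: ord2P;
    rewrite !mxE ?area_delta /area /= ?mxE /= -/x -/y -/b -/d ?yE ?b0 ?x1; ring.
(* The image of [g - 1] is spanned by its first row (x - 1, b). *)
exists b, (\row_j (if j == ord0 then (x - 1) / b else 1)); split.
  by rewrite rV2_eq0 !mxE /= oner_eq0 andbF.
have dE : d = - (x - 1) ^+ 2 / b.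
  by apply: (mulfI b0); rewrite -(subr0 (b * d)) -nil; field.
apply/matrixP; apply: ord2P; apply: ord2P;
  rewrite !mxE ?area_delta /area /= ?mxE /= -/x -/y -/b -/d ?yE ?dE; by field.
Qed.

End Plane.

(** * Stabilizers of 3-subsets of the projective line *)

Section Triples.

Variable F : finFieldType.
Implicit Types (u v w : 'rV[F]_2) (g : 'M[F]_2) (S : {set {set 'rV[F]_2}}).

Lemma rowgZ (a : F) u : a != 0 -> rowg (a *: u) = rowg u.
Proof. by move=> a0; apply/eq_rowg/eqmx_scale. Qed.

Lemma rowg_colinear u v : rowg u = rowg v -> exists a, u = a *: v.
Proof. by move=> uv; apply/sub_rVP; rewrite -rowgS uv. Qed.

Lemma rowg_neq u v : area u v != 0 -> rowg u != rowg v.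
Proof.
apply: contraNneq => /rowg_colinear[a ->].
by rewrite areaZl areavv mulr0.
Qed.

Lemma rowg_mulmx g u :
  g \in unitmx -> [set v *m g | v in rowg u] = rowg (u *m g).
Proof.
move=> Ug; apply/setP=> w; rewrite mem_rowg; apply/imsetP/idP=> [[v] | wug].
  by rewrite mem_rowg => vu ->; apply: submxMr.
exists (w *m invmx g); last by rewrite mulmxKV.
by rewrite mem_rowg -(mulmxK Ug u) submxMr.
Qed.

(** Representing a 3-subset by vectors of zero sum makes the three points play
    symmetric roles: any two of the vectors, in cyclic order, have the same
    area. *)
Definition zero_sum_lines u v : {set {set 'rV[F]_2}} :=
  [set rowg u; rowg v; rowg (- (u + v))].

Lemma zero_sum_lines_mulmx g u v : g \in unitmx ->
  [set [set w *m g | w in L] | L : {set 'rV[F]_2} in zero_sum_lines u v]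
  = zero_sum_lines (u *m g) (v *m g).
Proof.
move=> Ug; rewrite /zero_sum_lines !imsetU !imset_set1 !rowg_mulmx //.
by rewrite mulNmx mulmxDl.
Qed.

Lemma zero_sum_lines_three u v :
  area u v != 0 -> zero_sum_lines u v \in three_subsets (proj_line F).
Proof.
move=> uv; have vw : area v (- (u + v)) != 0.
  by rewrite areaNr areaDr areavv addr0 -areaC.
have uw : area u (- (u + v)) != 0.
  by rewrite areaNr areaDr areavv add0r oppr_eq0.
have [/andP[u0 v0] /andP[_ w0]] := (area_neq0 uv, area_neq0 uw).
rewrite inE; apply/andP; split.
  apply/subsetP=> L; rewrite !inE -orbA => /or3P[] /eqP ->; apply/imsetP.
  - by exists u; rewrite ?inE.
  - by exists v; rewrite ?inE.
  - by exists (- (u + v)); rewrite ?inE.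
rewrite /zero_sum_lines -setUA cardsU1 cards2 !inE negb_or.
by rewrite !rowg_neq.
Qed.

Lemma three_zero_sum S :
  S \in three_subsets (proj_line F) ->
  exists u v, area u v != 0 /\ S = zero_sum_lines u v.
Proof.
rewrite inE => /andP[/subsetP SP S3].
have /set0Pn[L LS]: S != set0 by rewrite -card_gt0 (eqP S3).
have [M [N [MN SD]]] : exists M N, M != N /\ S :\ L = [set M; N].
  by apply/cards2P; move: S3; rewrite (cardsD1 L) LS.
have [LM LN]: L != M /\ L != N.
  by split; apply/eqP=> E; have := setD11 L S; rewrite SD !inE E eqxx ?orbT.
have ES : S = [set L; M; N] by rewrite -setUA -SD setD1K.
have line (K : {set 'rV_2}) : K \in S ->
    exists2 u : 'rV[F]_2, u != 0 & K = rowg u.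
  by case/SP/imsetP=> u; rewrite inE; exists u.
have [u u0 Lu] := line L LS.
have [v v0 Mv] : exists2 v : 'rV[F]_2, v != 0 & M = rowg v.
  by apply: line; rewrite ES !inE eqxx orbT.
have [w w0 Nw] : exists2 w : 'rV[F]_2, w != 0 & N = rowg w.
  by apply: line; rewrite ES !inE eqxx orbT.
have neq (x y : 'rV[F]_2) :
    x != 0 -> y != 0 -> rowg x != rowg y -> area x y != 0.
  move=> x0 y0; apply: contraNneq => /(area0_colinear x0)[a ya].
  rewrite ya rowgZ //; apply: contraNneq y0 => a0.
  by rewrite ya a0 scale0r.
have uv : area u v != 0 by apply: neq; rewrite // -Lu -Mv.
have uw : area u w != 0 by apply: neq; rewrite // -Lu -Nw.
have vw : area v w != 0 by apply: neq; rewrite // -Mv -Nw.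
have wu : area w u != 0 by rewrite areaC oppr_eq0.
(* The linear relation between u, v and w rescales them to a zero sum. *)
exists (area v w *: u), (area w u *: v); split.
  by rewrite areaZl areaZr !mulf_neq0.
have wE : - (area v w *: u + area w u *: v) = area u v *: w.
  by apply/eqP; rewrite eq_sym -addr_eq0 addrC area_relation.
by rewrite ES /zero_sum_lines wE !rowgZ // -Lu -Mv -Nw.
Qed.

Hypothesis char3 : 3%:R = 0 :> F.
Hypothesis nonsquareN1 : forall a : F, a ^+ 2 != -1.

(** Let [u], [v], [w] have zero sum and span the three lines, and let [g] map
    them to [a], [b], [c] times a permutation of themselves.  As [g] preserves
    areas, [a b], [b c] and [c a] all equal the sign of the permutation.  An odd
    permutation would give [a ^+ 2 = -1]; for an even one, up to sign,
    [a = b = c = 1] and [mxtrace_area] gives the trace 2 for the identity and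
    -1 for a 3-cycle, whose squares are 1 in characteristic 3. *)
Lemma three_stabilizer_tr S g :
  S \in three_subsets (proj_line F) -> \det g = 1 ->
  [set [set w *m g | w in L] | L : {set 'rV[F]_2} in S] = S ->
  \tr g ^+ 2 = 1.
Proof.
case/three_zero_sum=> u [v [uv0 ->]] det1.
have Ug : g \in unitmx by rewrite unitmxE det1 unitr1.
rewrite zero_sum_lines_mulmx // => gS.
set w := - (u + v); set d := area u v in uv0.
have vw : area v w = d by rewrite areaNr areaDr areavv addr0 -areaC.
have wu : area w u = d by rewrite areaNl areaDl areavv add0r -areaC.
have [uw wv vu] : [/\ area u w = - d, area w v = - d & area v u = - d].
  by split; rewrite areaC ?wu ?vw.
have wgE : w *m g = - (u *m g + v *m g) by rewrite mulNmx mulmxDl.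
have img x : x \in [:: u; v; w] ->
    [\/ exists a, x *m g = a *: u, exists a, x *m g = a *: v
      | exists a, x *m g = a *: w].
  move=> xP; have : rowg (x *m g) \in zero_sum_lines u v.
    rewrite -gS !inE -wgE.
    by move: xP; rewrite !inE => /or3P[] /eqP->; rewrite eqxx ?orbT.
  rewrite !inE -orbA -/w => /or3P[] /eqP /rowg_colinear; by constructor.
have inv x y : area (x *m g) (y *m g) = area x y.
  by rewrite area_mulmx det1 mul1r.
have tr2 : \tr g * d = area (u *m g) v + area u (v *m g).
  exact: mxtrace_area.
have [uP vP wP] : [/\ u \in [:: u; v; w], v \in [:: u; v; w]
   & w \in [:: u; v; w]] by rewrite !inE !eqxx !orbT.
have := (inv u v, inv v w, inv w u); rewrite -/d vw wu.
have dN0 : 0 <> d by move=> d0; rewrite -d0 eqxx in uv0.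
have even_squares a b c :
    a * (b * d) = d -> b * (c * d) = d -> c * (a * d) = d ->
    [/\ a ^+ 2 = 1, b ^+ 2 = 1 & a * b = 1].
  move=> abd bcd cad.
  have [ab bc ca] : [/\ a * b = 1, b * c = 1 & c * a = 1].
    by split; apply: (mulIf uv0); rewrite mul1r -mulrA.
  split=> //.
    have -> : a ^+ 2 = a * b * (c * a) + a ^+ 2 * (1 - b * c) by ring.
    by rewrite ab bc ca; ring.
  have -> : b ^+ 2 = a * b * (b * c) + b ^+ 2 * (1 - c * a) by ring.
  by rewrite ab bc ca; ring.
have odd_absurd a b c :
    a * (b * - d) = d -> b * (c * - d) = d -> c * (a * - d) = d -> False.
  move=> abd bcd cad.
  have [ab bc ca] : [/\ a * b = -1, b * c = -1 & c * a = -1].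
    by split; apply: (mulIf uv0); apply/oppr_inj;
      rewrite mulN1r opprK -!mulrN -mulrA.
  have /eqP := nonsquareN1 a; apply.
  have -> : a ^+ 2 = a ^+ 2 * (1 + b * c) - a * b * (c * a) by ring.
  by rewrite ab bc ca; ring.
(* Of the 27 possible images of the three lines, only the six permutations are
   compatible with nonzero areas: three even ones and three odd ones. *)
case: (img u uP) tr2 => -[a ->]; case: (img v vP) => -[b ->];
case: (img w wP) => -[c ->]; rewrite !(areaZl, areaZr);
rewrite ?(areavv, uw, wv, vu, vw, wu) -/d ?mulr0 => tr2 [[] // abd bcd cad].
2,3,6: by case: (odd_absurd _ _ _ abd bcd cad).
- have [a2 b2 ab] := even_squares _ _ _ abd bcd cad.
  have -> : \tr g = a + b by apply: (mulIf uv0); rewrite mulrDl.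
  have -> : (a + b) ^+ 2 = a ^+ 2 + b ^+ 2 + 2%:R * (a * b) by ring.
  have -> : a ^+ 2 + b ^+ 2 + 2%:R * (a * b) = 1 + 3%:R :> F.
    by rewrite a2 b2 ab; ring.
  by rewrite char3 addr0.
- have [_ b2 _] := even_squares _ _ _ abd bcd cad.
  have -> : \tr g = - b by apply: (mulIf uv0); rewrite tr2; ring.
  by rewrite sqrrN.
- have [a2 _ _] := even_squares _ _ _ abd bcd cad.
  have -> : \tr g = - a by apply: (mulIf uv0); rewrite tr2; ring.
  by rewrite sqrrN.
Qed.

End Triples.

(** * Transvections in SL_2 and PSL_2 *)

Section Transvections.

Variable F : finFieldType.
Implicit Types (c d : F) (u v w : 'rV[F]_2) (g h : {'GL_2[F]}).

Lemma GLval_inj : injective (@GLval 2 F).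
Proof. exact: val_inj. Qed.

Lemma transvection_unit c v : transvection c v \in unitmx.
Proof. by rewrite unitmxE det_transvection unitr1. Qed.

Definition gl_transvection c v : {'GL_2[F]} :=
  FinRing.unit 'M[F]_2 (transvection_unit c v).

Definition psl_transvection c v : coset_of 'Z(SL2 F) :=
  coset 'Z(SL2 F) (gl_transvection c v).

Lemma transvection_SL2 c v : gl_transvection c v \in SL2 F.
Proof. by rewrite inE /= det_transvection. Qed.

Lemma SL2_normZ g : g \in SL2 F -> g \in 'N('Z(SL2 F))%g.
Proof. exact: (subsetP (normal_norm (center_normal _))). Qed.

Lemma psl_transvection_PSL2 c v : psl_transvection c v \in PSL2 F.
Proof. by rewrite mem_quotient ?transvection_SL2. Qed.

Lemma psl_transvectionZ c a v :
  psl_transvection c (a *: v) = psl_transvection (c * a ^+ 2) v.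
Proof.
by congr (coset _ _); apply: GLval_inj; rewrite /= transvectionZ.
Qed.

Lemma psl_transvection0 v : psl_transvection 0 v = 1%g.
Proof.
rewrite -(coset_id (group1 'Z(SL2 F))).
by congr (coset _ _); apply: GLval_inj; rewrite /= transvection0.
Qed.

Lemma gl_transvection_div c d v w :
  GLval (gl_transvection c v * (gl_transvection d w)^-1)%g
  = transvection c v *m transvection (- d) w.
Proof.
have -> : ((gl_transvection d w)^-1 = gl_transvection (- d) w)%g.
  apply/eqP; rewrite eq_invg_mul; apply/eqP/GLval_inj.
  by rewrite !GL_MxE /= transvectionD subrr transvection0.
by rewrite GL_MxE.
Qed.

Lemma scalar_center_SL2 g a :
  a ^+ 2 = 1 -> GLval g = a%:M -> g \in 'Z(SL2 F)%g.
Proof.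
move=> a2 ga; apply/centerP; split; first by rewrite inE ga det_scalar a2.
by move=> h _; apply: GLval_inj; rewrite !GL_MxE /= ga scalar_mxC.
Qed.

(** The class of [g] contains [- g], so the trace can be taken to be 2. *)
Lemma PSL2_transvection g :
  g \in SL2 F -> \tr (GLval g) = 2%:R \/ \tr (GLval g) = - 2%:R ->
  exists c v, v != 0 /\ coset 'Z(SL2 F) g = psl_transvection c v.
Proof.
move=> Sg; have /[!inE] /eqP det1 := Sg; case=> trg.
  have [c [v [v0 gE]]] := unipotent_transvection det1 trg.
  by exists c, v; split=> //; congr (coset _ _); apply: GLval_inj.
have [||c [v [v0 gE]]] := @unipotent_transvection _ (- GLval g).
- by rewrite -scaleN1r detZ det1 mulr1 sqrrN expr1n.
- by rewrite raddfN /= trg opprK.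
exists c, v; split=> //; apply/rcoset_kercosetP.
- exact: SL2_normZ.
- exact/SL2_normZ/transvection_SL2.
have U1 : ((-1)%:M : 'M[F]_2) \in unitmx.
  by rewrite unitmxE det_scalar unitrX ?unitrN1.
apply/rcosetP; exists (FinRing.unit 'M[F]_2 U1).
  by apply: (@scalar_center_SL2 _ (-1)); rewrite //= sqrrN expr1n.
by apply: GLval_inj; rewrite GL_MxE /= -gE mul_scalar_mx scaleN1r opprK.
Qed.

End Transvections.

(** * Upper bound for intersecting families *)

Section Cliques.

Variable F : finFieldType.
Hypothesis char3 : 3%:R = 0 :> F.
Hypothesis nonsquareN1 : forall a : F, a ^+ 2 != -1.
Implicit Types (c d : F) (u v w : 'rV[F]_2) (g h : {'GL_2[F]}).

Lemma zero_sum_lines_rot u v :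
  zero_sum_lines v (- (u + v)) = zero_sum_lines u v.
Proof.
rewrite /zero_sum_lines; have -> : - (v - (u + v)) = u by rewrite opprB addrK.
by apply/setP=> L; rewrite !inE orbC orbA.
Qed.

(** In characteristic 3 a transvection other than 1 has order 3, and permutes
    cyclically the lines of [w], [w - c v] and [w - 2 c v = w + c v]; these
    vectors have zero sum. *)
Lemma transvection_fixes_three c v : v != 0 ->
  exists2 S, S \in three_subsets (proj_line F) &
    [set [set w *m transvection c v | w in L] | L : {set 'rV[F]_2} in S] = S.
Proof.
move=> v0; have [w vw] := area_dual v0.
have wv : area w v = -1 by rewrite areaC vw.
have [-> | c0] := eqVneq c 0.
  exists (zero_sum_lines v w).
    by rewrite zero_sum_lines_three // vw oner_neq0.
  by rewrite zero_sum_lines_mulmx ?transvection_unit // transvection0 !mulmx1.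
exists (zero_sum_lines w (w - c *: v)).
  rewrite zero_sum_lines_three // areaDr areaNr areaZr areavv add0r.
  by rewrite wv mulrN1 opprK.
rewrite zero_sum_lines_mulmx ?transvection_unit // !mul_transvection.
rewrite areaDl areaNl areaZl areavv mulr0 subr0 wv mulrN1 scaleNr.
rewrite -(zero_sum_lines_rot w); congr (zero_sum_lines _ _).
apply/eqP; rewrite -subr_eq0 opprK.
have -> : w - c *: v - c *: v + (w + (w - c *: v)) = 3%:R *: (w - c *: v).
  by apply/rowP=> i; rewrite !mxE; ring.
by rewrite char3 scale0r.
Qed.

Definition unipotent_clique : {set coset_of 'Z(SL2 F)} -> Prop :=
  @ratio_clique _ (SL2_group F) 'Z(SL2 F)%G (fun g => \tr (GLval g) ^+ 2 = 1).

Lemma intersecting_clique (A : {set coset_of 'Z(SL2 F)}) :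
  intersecting (PSL2_act F) (three_subsets (proj_line F)) A ->
  unipotent_clique A.
Proof.
apply: (@intersecting_ratio_clique _ _ _ _ _ (GL2_act F)) => g S Sg VS.
  by rewrite PSL2_actE // -GL2_actE.
rewrite GL2_actE; apply: (three_stabilizer_tr char3 nonsquareN1 VS).
by move: Sg; rewrite inE => /eqP.
Qed.

(** With [t = c d area(v, w)^2], the trace condition is
    [(2 + t)^2 = 1], which reads [t (t + 1) = 0] in characteristic 3. *)
Lemma clique_area (A : {set coset_of 'Z(SL2 F)}) c d v w :
  unipotent_clique A ->
  psl_transvection c v \in A -> psl_transvection d w \in A ->
  c * d * area v w ^+ 2 = 0 \/ c * d * area v w ^+ 2 = -1.
Proof.
move=> clA cA dA.
have := clA _ _ (transvection_SL2 c v) (transvection_SL2 d w) cA dA.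
rewrite gl_transvection_div tr_transvectionM; set t := c * d * _ => t1.
have : t * (t + 1) == 0.
  have -> : t * (t + 1) = (2%:R + t) ^+ 2 - 1 - 3%:R * (t + 1) by ring.
  by rewrite t1 char3 mul0r subr0 subrr.
rewrite mulf_eq0 addr_eq0 => /orP[] /eqP; by [left | right].
Qed.

Lemma clique_elt (A : {set coset_of 'Z(SL2 F)}) x :
  A \subset PSL2 F -> unipotent_clique A -> 1%g \in A -> x \in A ->
  exists c v, v != 0 /\ x = psl_transvection c v.
Proof.
move=> /subsetP sA clA A1 xA; have /morphimP[g _ Sg xE] := sA x xA.
rewrite xE; apply: PSL2_transvection => //.
have : \tr (GLval g) ^+ 2 == 1.
  rewrite -(clA g 1%g) ?group1 ?invg1 ?mulg1 -?xE //.
  by rewrite coset_id ?group1.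
have two : 2%:R = -1 :> F.
  by apply/eqP; rewrite -subr_eq0 opprK -(natrD _ 2 1) char3.
rewrite two opprK sqrf_eq1 => /orP[] /eqP ->; by [right | left].
Qed.

Lemma card_ge3 : (3 <= #|F|)%N.
Proof.
have neq : (-1 : F) != 1 by rewrite eq_sym -{1}(expr1n F 2) nonsquareN1.
have neq0 : (-1 : F) != 0 by rewrite oppr_eq0 oner_neq0.
have := max_card [set 0; 1; -1 : F].
rewrite -setUA cardsU1 cards2 !inE negb_or.
by rewrite eq_sym oner_neq0 eq_sym neq0 eq_sym neq.
Qed.

(** Two members with different directions leave no room for any further one
    besides 1; otherwise all members lie in one group of transvections. *)
Lemma card_clique1 (A : {set coset_of 'Z(SL2 F)}) :
  A \subset PSL2 F -> unipotent_clique A -> 1%g \in A -> (#|A| <= #|F|)%N.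
Proof.
move=> sA clA A1; have eltA := clique_elt sA clA A1.
have [sub1 | /subsetPn[x xA]] := boolP (A \subset [set 1%g]).
  apply: leq_trans (subset_leq_card sub1) _; rewrite cards1.
  exact: leq_trans card_ge3.
have [c [v [v0 xE]]] := eltA x xA; rewrite {x}xE in xA * => x1.
have c0 : c != 0.
  by apply: contraNneq x1 => ->; rewrite psl_transvection0 inE.
have [subv | /subsetPn[y yA]] :=
  boolP (A \subset [set psl_transvection c' v | c' : F]).
  by apply: leq_trans (subset_leq_card subv) _; apply: leq_imset_card.
have [d [w [w0 yE]]] := eltA y yA; rewrite {y}yE in yA * => yv.
have d0 : d != 0.
  apply: contraNneq yv => ->; apply/imsetP; exists 0 => //.
  by rewrite !psl_transvection0.
have vw : area v w != 0.
  apply: contraNneq yv => /(area0_colinear v0)[a ->].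
  by rewrite psl_transvectionZ; apply: imset_f.
have cdvw : c * d * area v w ^+ 2 = -1.
  case: (clique_area clA xA yA) => // /eqP.
  by rewrite !mulf_eq0 (negPf c0) (negPf d0) (negPf vw).
suff /subset_leq_card sA3 :
    A \subset [set 1%g; psl_transvection c v; psl_transvection d w].
  apply: leq_trans sA3 (leq_trans _ card_ge3).
  by rewrite -setUA cardsU1 cards2; case: (_ \notin _); case: (_ != _).
apply/subsetP=> z zA; have [e [u [u0 zE]]] := eltA z zA; rewrite zE in zA *.
rewrite !inE -orbA.
have [-> | e0] := eqVneq e 0; first by rewrite psl_transvection0 eqxx.
case: (clique_area clA xA zA) => [/eqP | cevu].
  rewrite !mulf_eq0 (negPf c0) (negPf e0) /= orbb.
  move=> /eqP /(area0_colinear v0)[a uE].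
  case: (clique_area clA zA yA) => [/eqP | edwu].
    rewrite uE areaZl !mulf_eq0 (negPf d0) (negPf e0) (negPf vw) !orbF orbb.
    by move=> /eqP a0; rewrite uE a0 scale0r eqxx in u0.
  rewrite uE psl_transvectionZ.
  have -> : e * a ^+ 2 = c.
    apply: (mulIf d0); apply: (mulIf (expf_neq0 2 vw)).
    by rewrite cdvw -edwu uE areaZl; ring.
  by rewrite eqxx orbT.
case: (clique_area clA yA zA) => [/eqP | dewu].
  rewrite !mulf_eq0 (negPf d0) (negPf e0) /= orbb.
  move=> /eqP /(area0_colinear w0)[a uE].
  rewrite uE psl_transvectionZ.
  have -> : e * a ^+ 2 = d.
    apply: (mulfI c0); apply: (mulIf (expf_neq0 2 vw)).
    by rewrite cdvw -cevu uE areaZr; ring.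
  by rewrite eqxx !orbT.
(* The three products c d, c e, d e cannot all be minus a square. *)
have /eqP[] := nonsquareN1 (c * d * e * area v w * area v u * area w u).
have -> : (c * d * e * area v w * area v u * area w u) ^+ 2
  = (c * d * area v w ^+ 2) * (c * e * area v u ^+ 2) * (d * e * area w u ^+ 2).
  by ring.
by rewrite cdvw cevu dewu mulrNN mulr1 mul1r.
Qed.

Lemma card_clique (A : {set coset_of 'Z(SL2 F)}) :
  A \subset PSL2 F -> unipotent_clique A -> (#|A| <= #|F|)%N.
Proof.
move=> sA clA; have [-> | [x xA]] := set_0Vmem A; first by rewrite cards0.
have Gx := subsetP sA x xA; have Gx1 : (x^-1)%g \in PSL2 F by rewrite groupV.
rewrite -(card_rcoset A x^-1); apply: card_clique1.
- by rewrite -(rcoset_id Gx1) rcosetS.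
- exact: (ratio_cliqueM (normal_norm (center_normal (SL2_group F))) Gx1 clA).
- by rewrite mem_rcoset invgK mul1g.
Qed.

End Cliques.

(** * The intersecting family of transvections along one vector *)

Section UnipotentSubgroup.

Variable F : finFieldType.
Hypothesis char3 : 3%:R = 0 :> F.
Implicit Types (c d : F) (v w : 'rV[F]_2).

(** A transvection that is a scalar matrix is trivial, so no two distinct ones
    along [v] differ by a central element. *)
Lemma psl_transvection_inj v :
  v != 0 -> injective (fun c => psl_transvection c v).
Proof.
move=> v0 c d; move/kercoset_rcoset.
case=> [||z Zz cd]; try exact/SL2_normZ/transvection_SL2.
have [a za] := center_SL2_scalar Zz; have [w vw] := area_dual v0.
have : transvection (c - d) v = a%:M.
  by rewrite -za -transvectionD -gl_transvection_div cd mulgK.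
move/(congr1 (fun g => area w (w *m g))).
rewrite mul_transvection mul_mx_scalar areaDr !areaZr areavv mulr0 add0r.
rewrite (areaC w) vw !mulrN1 opprK => /eqP.
by rewrite subr_eq0 => /eqP.
Qed.

Lemma transvections_intersecting v : v != 0 ->
  intersecting (PSL2_act F) (three_subsets (proj_line F))
    [set psl_transvection c v | c : F].
Proof.
move=> v0; apply/forall_inP=> _ /imsetP[c _ ->].
apply/forall_inP=> _ /imsetP[d _ ->]; apply/exists_inP.
have [S VS fixS] := transvection_fixes_three char3 (c - d) v0.
exists S => //; rewrite !PSL2_actE ?transvection_SL2 // -!GL2_actE.
apply/eqP/act_eq_fixP; rewrite GL2_actE.
by rewrite gl_transvection_div transvectionD.
Qed.

End UnipotentSubgroup.

(** * Orders of PSL_2 and of the set of 3-subsets *)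

Section Counting.

Variable F : finFieldType.

(** The points are the lines of the vectors (1, a) and of (0, 1). *)
Lemma card_proj_line : #|proj_line F| = #|F|.+1.
Proof.
pose p (o : option F) : 'rV[F]_2 :=
  if o is Some a then \row_j (if j == ord0 then 1 else a)
  else \row_j (if j == ord0 then 0 else 1).
have p0 o : p o != 0.
  by case: o => [a|]; rewrite rV2_eq0 !mxE /= oner_eq0 ?andbF.
rewrite -card_option -(card_imset _ (f := fun o => rowg (p o))); last first.
  move=> o1 o2 /eqP E; apply: contraTeq E => o12; apply: rowg_neq.
  case: o1 o2 o12 => [a|] [b|] //= ab; rewrite /area !mxE /=.
  - by rewrite mul1r mulr1 subr_eq0 eq_sym; apply: contraNneq ab => ->.
  - by rewrite mulr0 subr0 mulr1 oner_neq0.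
  - by rewrite mul0r sub0r mulr1 oppr_eq0 oner_neq0.
apply: eq_card => L; apply/imsetP/imsetP=> [[v] | [o _ ->]]; last first.
  by exists (p o); rewrite ?inE.
rewrite inE rV2_eq0 => v0 ->; have [x0 | x0] := eqVneq (v 0 ord0) 0.
  have y0 : v 0 ord_max != 0 by move: v0; rewrite x0 eqxx.
  exists None; rewrite // -(rowgZ (p None) y0); congr rowg.
  by apply/rowP; apply: ord2P; rewrite !mxE /= ?x0 ?mulr0 ?mulr1.
exists (Some (v 0 ord_max / v 0 ord0)); rewrite // -[RHS](rowgZ _ x0).
congr rowg; apply/rowP; apply: ord2P; rewrite !mxE /= ?mulr1 //.
by rewrite mulrCA divff ?mulr1.
Qed.

Lemma card_three_subsets : (#|three_subsets (proj_line F)| * 6 =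
  #|F|.+1 * #|F| * #|F|.-1)%N.
Proof.
rewrite /three_subsets cards_draws card_proj_line.
by rewrite (bin_ffact _ 3) /falling_factorial /= muln1 mulnA.
Qed.

Definition GLdet_unit (g : {'GL_2[F]}) : {unit F} :=
  FinRing.unit F (GL_unitmx g).

Lemma GLdet_morph : {in 'GL_2[F] &, {morph GLdet_unit : g h / (g * h)%g}}.
Proof.
by move=> g h _ _; apply: val_inj; apply: det_mulmx.
Qed.

(** SL_2 is the kernel of the determinant, which maps GL_2 onto the group of
    units. *)
Lemma card_SL2 : (#|SL2 F| * #|F|.-1 = #|'GL_2[F]|)%N.
Proof.
pose f := Morphism GLdet_morph.
have kerf : 'ker f = SL2 F.
  apply/setP=> g; rewrite !inE /=.
  by apply/eqP/eqP=> [/(congr1 val) | g1]; last exact: val_inj.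
have imf : f @* 'GL_2[F] = [set: {unit F}].
  apply/setP=> u; rewrite inE; apply/morphimP.
  pose m : 'M[F]_2 := diag_mx (\row_j (if j == ord0 then val u else 1)).
  have dm : \det m = val u.
    by rewrite det_diag !big_ord_recl big_ord0 !mxE /= !mulr1.
  have Um : m \in unitmx by rewrite unitmxE dm; apply: (valP u).
  by exists (FinRing.unit 'M[F]_2 Um); rewrite ?inE //; apply: val_inj.
have := card_morphim f 'GL_2[F]; rewrite imf card_finField_unit kerf setIid.
by move=> ->; rewrite (@Lagrange _ 'GL_2[F] (SL2_group F)) ?subsetT.
Qed.

Lemma card_center_SL2 : -1 != 1 :> F -> #|'Z(SL2 F)%g| = 2%N.
Proof.
move=> N1; have U1 : ((-1)%:M : 'M[F]_2) \in unitmx.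
  by rewrite unitmxE det_scalar unitrX ?unitrN1.
pose z : {'GL_2[F]} := FinRing.unit 'M[F]_2 U1.
have -> : 'Z(SL2 F)%g = [set 1%g; z].
  apply/setP=> g; rewrite [RHS]in_set2; apply/idP/orP=> [Zg | [] /eqP->].
  - have [a ga] := center_SL2_scalar Zg.
    have : a ^+ 2 == 1.
      by have /setIP[/[!inE] /eqP <- _] := Zg; rewrite ga det_scalar.
    rewrite sqrf_eq1 => /orP[] /eqP aE; [left | right]; apply/eqP/GLval_inj.
      by rewrite ga aE.
    by rewrite ga aE.
  - exact: group1.
  - by apply: (@scalar_center_SL2 _ _ (-1)); rewrite ?sqrrN ?expr1n.
rewrite cards2 (_ : 1%g != z) //; apply: contraNneq N1 => /(congr1 GLval).
by move/matrixP/(_ ord0 ord0); rewrite !mxE /= => /esym /eqP.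
Qed.

Lemma card_PSL2 : -1 != 1 :> F ->
  #|PSL2 F| = (3 * #|three_subsets (proj_line F)|)%N.
Proof.
move=> N1; have q1 := finNzRing_gt1 F.
have cG : (#|PSL2 F| * 2 = #|SL2 F|)%N.
  rewrite card_quotient ?(normal_norm (center_normal (SL2_group F))) //.
  have := @Lagrange _ (SL2_group F) 'Z(SL2 F)%G (center_sub _).
  by rewrite card_center_SL2 // mulnC.
have q10 : (0 < #|F|.-1)%N by rewrite -subn1 subn_gt0.
set q' := #|F|.-1 in q10.
have q20 : (0 < 2 * q')%N by rewrite muln_gt0.
apply/eqP; rewrite -(eqn_pmul2r q20) mulnA cG card_SL2 card_GL_2 -/q'.
have -> : (3 * #|three_subsets (proj_line F)| * (2 * q')
           = #|three_subsets (proj_line F)| * 6 * q')%N by ring.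
by rewrite card_three_subsets -/q'; apply/eqP; ring.
Qed.

End Counting.

(** * Arithmetic of odd powers of 3, and the density *)

(** If [a ^+ 2 = -1] then [a ^+ (q - 1)] is an odd power of -1, while it is 1
    by Fermat's little theorem. *)
Lemma card3mod4_nonsquareN1 (F : finFieldType) (a : F) (k : nat) :
  #|F| = (4 * k + 3)%N -> -1 != 1 :> F -> a ^+ 2 != -1.
Proof.
move=> cF; apply: contraNneq => a2.
have a0 : a != 0.
  apply: contraTneq isT => a0.
  by have := oner_neq0 F; rewrite -oppr_eq0 -a2 a0 expr0n eqxx.
have := expf_card a.
rewrite cF (_ : 4 * k + 3 = (2 * (2 * k + 1)).+1)%N; last by ring.
rewrite exprS exprM a2 exprD exprM sqrrN expr1n expr1n mul1r expr1.
by move/(canRL (mulKf a0)) => ->; rewrite mulVf.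
Qed.

Lemma three_pow_odd_mod4 (l : nat) : exists k, (3 ^ (2 * l + 1) = 4 * k + 3)%N.
Proof.
elim: l => [|l [k IH]]; first by exists 0%N.
exists (9 * k + 6)%N; rewrite mulnS -addnA expnD IH; ring.
Qed.

Theorem theorem5p1 (l q : nat) (F : finFieldType)
    (hq : q = (3 ^ (2 * l + 1))%N) (hF : #|F| = q) :
  intersection_density (PSL2_act F) (PSL2 F) (three_subsets (proj_line F))
  = q%:R / 3%:R.
Proof.
have char3 : 3%:R = 0 :> F.
  have : 3 \in [pchar F].
    by apply: card_finPcharP (isT : prime 3); rewrite hF hq.
  by move/pcharf0.
have N1 : -1 != 1 :> F.
  apply: contraTneq isT => N11; have := oner_neq0 F.
  have -> : 1 = 3%:R - (1 - (-1)) :> F by ring.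
  by rewrite char3 N11 subrr subrr eqxx.
have [k qk] := three_pow_odd_mod4 l.
have nsq (a : F) : a ^+ 2 != -1.
  by apply: (@card3mod4_nonsquareN1 _ _ k); rewrite ?hF ?hq.
have G0 : (0 < #|PSL2 F|)%N by apply: cardG_gt0.
have V0 : (0 < #|three_subsets (proj_line F)|)%N.
  by move: G0; rewrite card_PSL2 // muln_gt0.
have ratio (n : nat) : n%:R * #|three_subsets (proj_line F)|%:R / #|PSL2 F|%:R
   = n%:R / 3%:R :> rat.
  rewrite card_PSL2 // natrM invfM mulrA mulrAC; congr (_ * _).
  by rewrite mulfK // pnatr_eq0 -lt0n.
pose v : 'rV[F]_2 := const_mx 1.
have v0 : v != 0 by rewrite rV2_eq0 !mxE oner_eq0.
apply/eqP; rewrite eq_le; apply/andP; split.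
  apply: bigmax_le => [|A /andP[sA /intersecting_clique clA]].
    exact: divr_ge0.
  rewrite ratio ler_pM2r ?invr_gt0 ?ltr0n // ler_nat -hF.
  by apply: card_clique => //; apply: clA.
rewrite -hF -(card_imset xpredT (psl_transvection_inj v0)) -ratio.
apply: le_bigmax_cond; rewrite transvections_intersecting // andbT.
by apply/subsetP=> _ /imsetP[c _ ->]; apply: psl_transvection_PSL2.
Qed.
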